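(* There does not exist any $((7,3,3))$ CWS code, even though the linear programming bound does not rule out this possibility (i.e. the linear programming bound for quantum codes does not exclude the existence of a $((7,3,3))$ quantum code).
   Context: All codes are subspaces of the $n$-qubit Hilbert space $(\mathbb{C}^2)^{\otimes n}$. The $n$-qubit Pauli group consists of the operators $\alpha\,e_1\otimes\cdots\otimes e_n$ with $\alpha\in\{\pm1,\pm i\}$ and $e_i\in\{I,X,Y,Z\}$; the weight of such an operator is the number of indices $i$ with $e_i\ne I$. CWS (codeword stabilized) code: let $S$ be an abelian subgroup of the $n$-qubit Pauli group with $|S|=2^n$ and $-I\notin S$, and let $|S\rangle$ be the (unique up to phase) unit vector with $s|S\rangle=|S\rangle$ for all $s\in S$ (a stabilizer state). Let $w_1,\dots,w_K$ be $n$-qubit Pauli operators (word operators) such that $w_1|S\rangle,\dots,w_K|S\rangle$ are mutually orthogonal. The CWS code is the $K$-dimensional span of $w_1|S\rangle,\dots,w_K|S\rangle$. (Up to local Clifford operations one may put a CWS code in standard form, where $|S\rangle$ is a graph state and $w_i=Z^{\mathbf{c}_i}$ with $\mathbf{c}_1=0$.) $((n,K,d))$ code: a $K$-dimensional subspace of $(\mathbb{C}^2)^{\otimes n}$, with orthogonal projector $P$, that detects all Pauli errors of weight less than $d$, i.e. for every Pauli operator $E$ of weight $<d$ there is a scalar $\lambda_E$ with $PEP=\lambda_E P$. Linear programming bound: the standard necessary condition for the existence of an $((n,K,d))$ quantum code ($K>1$), coming from its weight enumerators $A_j=\frac{1}{K^2}\sum_{\mathrm{wt}(E)=j}|\mathrm{Tr}(EP)|^2$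 and $B_j=\frac1K\sum_{\mathrm{wt}(E)=j}\mathrm{Tr}(EPE^\dagger P)$ (sums over phase-free Pauli operators). It requires that there be real numbers $A_0,\dots,A_n$ with $A_0=1$ such that, writing $K_j(r)=\sum_s(-1)^s3^{j-s}\binom{r}{s}\binom{n-r}{j-s}$ and $B_j=\frac{K}{2^n}\sum_r K_j(r)A_r$, one has $B_j\ge A_j\ge 0$ for all $j$, $B_j=A_j$ for $j<d$, and $\frac{K}{2^n}\sum_r(-1)^rK_j(r)A_r\ge 0$ for all $j$ (the shadow constraints). The bound ''rules out'' parameters $((n,K,d))$ if this system of linear constraints has no solution. *)

(* Defs.v *)
From HB Require Import structures.
From mathcomp Require Import all_boot all_order all_algebra.
From mathcomp Require Import finmap.
From mathcomp Require Export reals complex.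

Set Implicit Arguments.
Unset Strict Implicit.
Unset Printing Implicit Defensive.

Import Order.TTheory GRing.Theory Num.Theory.

Local Open Scope ring_scope.
Local Open Scope sesquilinear_scope.

Inductive pauli1 := PauliI | PauliX | PauliY | PauliZ.

Definition pauli1_bits (e : pauli1) : bool * bool :=
  match e with
  | PauliI => (false, false) | PauliX => (true, false)
  | PauliY => (true, true) | PauliZ => (false, true)
  end.

Definition pauli1_of_bits (b : bool * bool) : pauli1 :=
  match b with
  | (false, false) => PauliI | (true, false) => PauliX
  | (true, true) => PauliY | (false, true) => PauliZ
  end.

Lemma pauli1_bitsK : cancel pauli1_bits pauli1_of_bits.
Proof. by case. Qed.

HB.instance Definition _ := Finite.copy pauli1 (can_type pauli1_bitsK).

(* The space (C^2)^{(x) n} in coordinates: the computational basis is indexed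
   by the bit strings of length n, i.e. by {ffun 'I_n -> 'I_2}, and columns of
   dimension [qdim n] = 2 ^ n are indexed by their enumeration. *)
Definition qdim (n : nat) : nat := #|{ffun 'I_n -> 'I_2}|.

Definition qbits (n : nat) (a : 'I_(qdim n)) : {ffun 'I_n -> 'I_2} :=
  @enum_val {ffun 'I_n -> 'I_2} predT a.

Definition pauli_wt (n : nat) (e : {ffun 'I_n -> pauli1}) : nat :=
  #|[set i | e i != PauliI]|.

Section Codes.

(* Instantiated with [R[i]], for R : realType, in the theorem. *)
Variable C : numClosedFieldType.

Definition mx22 (a b c d : C) : 'M[C]_2 :=
  \matrix_(i, j) if i == 0 then (if j == 0 then a else b)
                 else (if j == 0 then c else d).

Definition pauli1_mx (e : pauli1) : 'M[C]_2 :=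
  match e with
  | PauliI => 1%:M
  | PauliX => mx22 0 1 1 0
  | PauliY => mx22 0 (- 'i) 'i 0
  | PauliZ => mx22 1 0 0 (- 1)
  end.

(* e_0 (x) ... (x) e_(n-1): the entry of a Kronecker product at a pair of bit
   strings is the product of the entries of its factors. *)
Definition pauli_tensor (n : nat) (e : {ffun 'I_n -> pauli1}) : 'M[C]_(qdim n) :=
  \matrix_(a, b) \prod_(i < n) pauli1_mx (e i) (qbits a i) (qbits b i).

(* The phases 1, i, -1, -i are the powers 'i ^+ k with k < 4. *)
Definition is_pauli (n : nat) (E : 'M[C]_(qdim n)) : Prop :=
  exists (k : 'I_4) (e : {ffun 'I_n -> pauli1}), E = 'i ^+ k *: pauli_tensor e.

(* Hermitian inner product, conjugate-linear in the first argument. *)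
Definition braket (m : nat) (u v : 'cV[C]_m) : C := (u ^t* *m v) 0 0.

Definition is_stabilizer (n : nat) (S : {fset 'M[C]_(qdim n)}) : Prop :=
  [/\ [/\ forall s, s \in S -> is_pauli s,
          1%:M \in S,
          forall s t, s \in S -> t \in S -> s *m t \in S
        & forall s, s \in S -> invmx s \in S],
      forall s t, s \in S -> t \in S -> s *m t = t *m s,
      #|` S|%fset = (2 ^ n)%N
    & - 1%:M \notin S].

Definition is_stabilizer_state (n : nat) (S : {fset 'M[C]_(qdim n)})
    (psi : 'cV[C]_(qdim n)) : Prop :=
  braket psi psi = 1 /\ forall s, s \in S -> s *m psi = psi.

Definition is_cws_code (n K : nat) (U : {vspace 'cV[C]_(qdim n)}) : Prop :=
  exists (S : {fset 'M[C]_(qdim n)}) (psi : 'cV[C]_(qdim n))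
         (w : 'I_K -> 'M[C]_(qdim n)),
  [/\ is_stabilizer S,
      is_stabilizer_state S psi,
      forall i, is_pauli (w i),
      forall i j, i != j -> braket (w i *m psi) (w j *m psi) = 0
    & U = <<[seq w i *m psi | i <- enum 'I_K]>>%VS].

Definition is_orth_projector (m : nat) (U : {vspace 'cV[C]_m}) (P : 'M[C]_m) :
    Prop :=
  [/\ P *m P = P, P ^t* = P & forall v, v \in U <-> P *m v = v].

Definition is_quantum_code (n K d : nat) (U : {vspace 'cV[C]_(qdim n)}) : Prop :=
  \dim U = K /\
  exists2 P : 'M[C]_(qdim n), is_orth_projector U P &
    forall (k : 'I_4) (e : {ffun 'I_n -> pauli1}), (pauli_wt e < d)%N ->
      exists lambda : C,
        P *m ('i ^+ k *: pauli_tensor e) *m P = lambda *: P.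

End Codes.

Section LinearProgrammingBound.

Variable R : realType.

(* In the terms with r < s or n - r < j - s a binomial coefficient vanishes;
   all subtractions of natural numbers are exact for r, j <= n. *)
Definition krawtchouk (n j r : nat) : R :=
  \sum_(s < j.+1)
    (-1) ^+ s * 3 ^+ (j - s)%N * ('C(r, s))%:R * ('C(n - r, j - s))%:R.

Definition lp_dual (n K : nat) (A : 'I_n.+1 -> R) (j : 'I_n.+1) : R :=
  K%:R / 2 ^+ n * \sum_(r < n.+1) krawtchouk n j r * A r.

Definition lp_shadow (n K : nat) (A : 'I_n.+1 -> R) (j : 'I_n.+1) : R :=
  K%:R / 2 ^+ n * \sum_(r < n.+1) (-1) ^+ r * krawtchouk n j r * A r.

Definition lp_solution (n K d : nat) (A : 'I_n.+1 -> R) : Prop :=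
  [/\ A ord0 = 1,
      forall j, 0 <= A j <= lp_dual K A j,
      forall j : 'I_n.+1, (j < d)%N -> lp_dual K A j = A j
    & forall j, 0 <= lp_shadow K A j].

(* Meaningful as a bound on quantum codes only for 1 < K. *)
Definition lp_rules_out (n K d : nat) : Prop :=
  ~ exists A : 'I_n.+1 -> R, lp_solution K d A.

End LinearProgrammingBound.

(* Main.v *)
(* Three words determine the same pairwise products, up to phase, as the group of
   order 4 generated by those products.  Hence if w_1, w_2, w_3 span a CWS code of
   distance 3 on the stabilizer S, then the elements of S commuting with u = w_1 w_2
   and v = w_1 w_3 form a stabilizer of order 2^5, whose code has dimension 4 and
   still has distance 3.  The linear programming bound with shadow constraints
   excludes ((7,4,3)); for a stabilizer code its inequalities are elementary
   character-sum identities on the labels in {I,X,Y,Z}^7. *)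
From HB Require Import structures.
Require Import Defs.
From mathcomp Require Import all_boot all_order all_algebra.
From mathcomp Require Import finmap.
From mathcomp Require Import zify ring lra.

Set Implicit Arguments.
Unset Strict Implicit.
Unset Printing Implicit Defensive.

Import Order.TTheory GRing.Theory Num.Theory.

Local Open Scope ring_scope.
Local Open Scope sesquilinear_scope.

(* The group law on labels: multiplication of Pauli matrices modulo phases. *)
Definition pauli1_add (p q : pauli1) : pauli1 :=
  let: (a, b) := pauli1_bits p in let: (c, d) := pauli1_bits q in
  pauli1_of_bits (a (+) c, b (+) d).

Lemma pauli1_addA : associative pauli1_add. Proof. by case; case; case. Qed.
Lemma pauli1_addC : commutative pauli1_add. Proof. by case; case. Qed.
Lemma pauli1_add0 : left_id PauliI pauli1_add. Proof. by case. Qed.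
Lemma pauli1_addN : left_inverse PauliI id pauli1_add. Proof. by case. Qed.

HB.instance Definition _ :=
  GRing.isZmodule.Build pauli1 pauli1_addA pauli1_addC pauli1_add0 pauli1_addN.

Definition anticomm1 (p q : pauli1) : bool :=
  [&& p != PauliI, q != PauliI & p != q].

Definition anticomm (n : nat) (e f : {ffun 'I_n -> pauli1}) : bool :=
  \big[addb/false]_i anticomm1 (e i) (f i).

(** * The commutation form and weight parity on labels *)

Section Labels.

Variable n : nat.
Implicit Types (e f g u v : {ffun 'I_n -> pauli1}).

Lemma anticomm1C p q : anticomm1 p q = anticomm1 q p.
Proof. by case: p; case: q. Qed.

Lemma anticomm1D p q r : anticomm1 p (q + r) = anticomm1 p q (+) anticomm1 p r.
Proof. by case: p; case: q; case: r. Qed.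

Lemma label_addrr e : e + e = 0.
Proof. by apply/ffunP => i; rewrite !ffunE; case: (e i). Qed.

Lemma anticommC e f : anticomm e f = anticomm f e.
Proof. by apply: eq_bigr => i _; rewrite anticomm1C. Qed.

Lemma anticommDr e f g : anticomm e (f + g) = anticomm e f (+) anticomm e g.
Proof.
by rewrite /anticomm -big_split; apply: eq_bigr => i _; rewrite ffunE anticomm1D.
Qed.

Lemma anticommDl e f g : anticomm (e + f) g = anticomm e g (+) anticomm f g.
Proof. by rewrite anticommC anticommDr !(anticommC g). Qed.

Lemma anticomm0l f : anticomm 0 f = false.
Proof. by rewrite /anticomm big1 // => i _; rewrite ffunE. Qed.

(** A label on a single site of the support of [f] suffices: each nonidentity Pauli matrix
    anticommutes with [X] or with [Z]. *)
Lemma anticomm_nondegenerate f : f != 0 -> exists e, anticomm e f.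
Proof.
move=> f0; have [i fi] : exists i, f i != 0.
  apply/existsP; apply: contraNT f0; rewrite negb_exists => /forallP H.
  by apply/eqP/ffunP => i; rewrite ffunE; apply/eqP; rewrite -[_ == _]negbK.
pose p := if f i == PauliX then PauliZ else PauliX.
exists [ffun j => if j == i then p else 0].
rewrite /anticomm (bigD1 i) //= big1 => [|j /negPf ji]; rewrite ffunE ?eqxx ?ji //.
by move: fi; rewrite addbF /p; case: (f i).
Qed.

Lemma wt0 : pauli_wt (0 : {ffun 'I_n -> pauli1}) = 0%N.
Proof. by apply/eqP; rewrite cards_eq0; apply/eqP/setP => i; rewrite !inE ffunE. Qed.

Lemma odd_wtE e : odd (pauli_wt e) = \big[addb/false]_i (e i != PauliI).
Proof.
rewrite /pauli_wt cardsE -sum1_card big_mkcond /=.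
rewrite (big_morph odd oddD (erefl _)).
by apply: eq_bigr => i _; rewrite unfold_in /=; case: (e i).
Qed.

(** A check on one site. On an isotropic set the last term vanishes, so weight parity is a
    character; the shadow inequalities rest on this. *)
Lemma odd_wtD e f :
  odd (pauli_wt (e + f)) = odd (pauli_wt e) (+) odd (pauli_wt f) (+) anticomm e f.
Proof.
rewrite !odd_wtE /anticomm -!big_split; apply: eq_bigr => i _ /=.
by rewrite ffunE; case: (e i); case: (f i).
Qed.

End Labels.

(** * Character sums over additive sets of labels, and duality *)

Section CharacterSums.

Variable n : nat.
Notation label := {ffun 'I_n -> pauli1}.
Implicit Types (e f g u v : label) (G : {set label}).

Definition additive_set G :=
  0 \in G /\ forall f g, f \in G -> g \in G -> f + g \in G.

Lemma card_label : #|{: label}| = (4 ^ n)%N.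
Proof.
rewrite card_ffun card_ord; congr (_ ^ _)%N.
rewrite (bij_eq_card (f := pauli1_bits)) ?card_prod ?card_bool //.
by exists pauli1_of_bits; [exact: pauli1_bitsK | case=> [[] []]].
Qed.

(** Translation by some [g] in [G] with [phi g] true permutes [G] and negates the sum. *)
Lemma sum_sign_additive G (phi : label -> bool) : additive_set G ->
  {in G &, {morph phi : f g / f + g >-> f (+) g}} ->
  \sum_(f in G) (-1) ^+ phi f =
    (if [forall f in G, ~~ phi f] then #|G|%:R else 0) :> int.
Proof.
move=> [_ GD] phiD; case: ifPn => [/forall_inP H|].
  rewrite (eq_bigr (fun=> 1)) ?sumr_const // => f /H /negPf -> //.
rewrite negb_forall => /existsP [g]; rewrite negb_imply negbK => /andP [gG phig].
set s := \sum_(f in G) _.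
suff sN : s = - s by apply/eqP; rewrite -[_ == _]orFb -(mulrn_eq0 s 2) mulr2n {1}sN addNr.
rewrite {1}/s (reindex_inj (addrI g)) -sumrN /=.
apply: eq_big => [f|f].
  apply/idP/idP => [/(GD _ _ gG)|/(GD _ _ gG) //].
  by rewrite addrA label_addrr add0r.
move=> /(GD _ _ gG); rewrite addrA label_addrr add0r => fG.
by rewrite phiD // phig signr_addb mulN1r.
Qed.

(** The dual for the commutation form: modulo phases, the centralizer of [G] in the Pauli group. *)
Definition annihilator G : {set label} :=
  [set e | [forall f in G, ~~ anticomm e f]].

Lemma sum_character G e : additive_set G ->
  \sum_(f in G) (-1) ^+ anticomm e f = #|G|%:R * (e \in annihilator G)%:R :> int.
Proof.
move=> Gadd; rewrite sum_sign_additive // => [|f g _ _]; last exact: anticommDr.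
by rewrite inE; case: ifP; rewrite ?mulr1 ?mulr0.
Qed.

Lemma additive_setT : additive_set setT.
Proof. by split=> *; rewrite !inE. Qed.

Lemma annihilatorT : annihilator setT = [set (0 : label)].
Proof.
apply/setP => e; rewrite !inE; apply/forall_inP/eqP => [H|-> f _].
  apply/eqP; apply: contraT => /anticomm_nondegenerate [f].
  by rewrite anticommC => /negPn; rewrite H.
by rewrite anticomm0l.
Qed.

(** Double counting of the signs over all [e] and all [f] in [G]: summing over [f] first gives the
    left side; summing over [e] first leaves only [f = 0], by nondegeneracy. *)
Lemma card_annihilator G : additive_set G -> (#|G| * #|annihilator G| = 4 ^ n)%N.
Proof.
move=> Gadd; apply/eqP; rewrite -(eqr_nat int) natrM.
have <- : \sum_e \sum_(f in G) (-1) ^+ anticomm e f =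
    #|G|%:R * #|annihilator G|%:R :> int.
  under eq_bigr do rewrite sum_character //.
  rewrite -mulr_sumr -natr_sum; congr (_ * _%:R).
  by rewrite -sum1_card [RHS]big_mkcond; apply: eq_bigr => e _; case: ifP.
rewrite exchange_big /=.
under eq_bigr => f _.
  under eq_bigr do rewrite anticommC.
  rewrite (eq_bigl (fun e => e \in setT)) => [|e]; last by rewrite inE.
  rewrite sum_character ?annihilatorT ?inE; last exact: additive_setT.
  over.
rewrite (bigD1 (0 : label)) /=; last by case: Gadd.
rewrite eqxx big1 => [|f /andP[_ /negPf ->]]; rewrite ?mulr0 //.
by rewrite cardsT card_label mulr1 addr0.
Qed.

Definition isotropic G := {in G &, forall e f, ~~ anticomm e f}.

(** Isotropy puts [G] inside its annihilator, and the two orders have product [4 ^ n], so the lower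
    bound forces equality. *)
Lemma self_dual G : additive_set G -> isotropic G -> (2 ^ n <= #|G|)%N ->
  annihilator G = G /\ #|G| = (2 ^ n)%N.
Proof.
move=> Gadd Giso leG; have := card_annihilator Gadd.
have sub : G \subset annihilator G.
  by apply/subsetP => e eG; rewrite inE; apply/forall_inP => f; apply: Giso.
have le2 := subset_leq_card sub.
have -> : (4 ^ n = 2 ^ n * 2 ^ n)%N by rewrite -expnMn.
have : (0 < 2 ^ n)%N by rewrite expn_gt0.
move: leG le2; set a := (2 ^ n)%N; set b := #|G|; set c := #|annihilator G|.
move=> ab bc a0 bcE.
have ba : b = a by nia.
split=> //; apply/eqP; rewrite eq_sym eqEcard sub -/b -/c; nia.
Qed.

(* (1 + chi_u) (1 + chi_v) is 4 times the indicator of the common kernel. *)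
Lemma sum_character_kernel G u v e : additive_set G -> annihilator G = G ->
  4 * \sum_(f in [set f in G | ~~ anticomm u f && ~~ anticomm v f])
        (-1) ^+ anticomm e f =
  #|G|%:R * ((e \in G) + (e + u \in G)%R + (e + v \in G)%R + (e + u + v \in G)%R)%:R
    :> int.
Proof.
move=> Gadd GK.
have sumE x : #|G|%:R * (x \in G)%:R = \sum_(f in G) (-1) ^+ anticomm x f :> int.
  by rewrite sum_character // GK.
rewrite !natrD !mulrDr !sumE -!big_split /=.
rewrite big_distrr /=.
rewrite (eq_bigl (fun f => (f \in G) && (~~ anticomm u f && ~~ anticomm v f))) => [|f];
  last by rewrite inE.
rewrite big_mkcondr; apply: eq_bigr => f _.
rewrite !anticommDl !signr_addb.
by case: (anticomm u f); case: (anticomm v f); rewrite /= ?expr1 ?expr0; ring.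
Qed.
End CharacterSums.

(** * Krawtchouk numbers as character sums over labels of fixed weight *)

Lemma coef_expr1DZX (c : int) (m k : nat) :
  ((1 + c *: 'X) ^+ m)`_k = c ^+ k * 'C(m, k)%:R.
Proof.
rewrite exprDn.
rewrite (eq_bigr (fun i : 'I_m.+1 => (c ^+ i * 'C(m, i)%:R) *: 'X^i)) => [|i _];
  last first.
  by rewrite expr1n mul1r exprZn mulr_natr scalerMnl.
rewrite -(poly_def _ (fun i => c ^+ i * 'C(m, i)%:R)) coef_poly.
by case: ltnP => // /bin_small ->; rewrite mulr0.
Qed.

Lemma big_pauli1 (T : nmodType) (F : pauli1 -> T) :
  \sum_p F p = F PauliI + F PauliX + F PauliY + F PauliZ.
Proof.
rewrite (reindex pauli1_of_bits) /=; last first.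
  by exists pauli1_bits => [[[] []] _|p _] //; exact: pauli1_bitsK.
rewrite (eq_bigr (fun b => F (pauli1_of_bits (b.1, b.2)))) => [|[] //].
rewrite -(pair_big predT predT (fun a b => F (pauli1_of_bits (a, b)))) /= !big_bool /=.
rewrite addrC ![_ + F PauliI]addrC [F PauliY + _]addrC -!addrA.
by rewrite [F PauliZ + _]addrC -!addrA.
Qed.

(** If [q] is not the identity, one nonidentity [p] commutes with it and two anticommute, whence the
    coefficient [1 - 2 = -1]. *)
Lemma sum_anticomm1 (q : pauli1) :
  \sum_p (-1) ^+ anticomm1 p q *: 'X^(p != PauliI) =
  1 + (if q == PauliI then 3 else -1) *: 'X :> {poly int}.
Proof.
rewrite big_pauli1.
by case: q => /=; rewrite ?expr0 ?expr1 ?scale1r ?scaleN1r -?mul_polyC; ring.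
Qed.

(** Sign and weight are both multiplicative over sites, so the sum factors into one-site sums. The
    right side is the generating function of the Krawtchouk numbers. *)
Lemma pauli_enumerator n (f : {ffun 'I_n -> pauli1}) :
  \sum_e (-1) ^+ anticomm e f *: 'X^(pauli_wt e) =
  (1 + (-1) *: 'X) ^+ pauli_wt f * (1 + 3 *: 'X) ^+ (n - pauli_wt f) :> {poly int}.
Proof.
transitivity
    (\prod_(i < n) \sum_p ((-1) ^+ anticomm1 p (f i) *: 'X^(p != PauliI) : {poly int})).
  rewrite bigA_distr_bigA; apply: eq_bigr => e _.
  rewrite (big_morph (fun b : bool => (-1) ^+ b : int) (@signr_addb _)
             (erefl : _ false = 1)).
  rewrite scaler_prod; congr (_ *: _).
  rewrite /pauli_wt cardsE -sum1_card big_mkcond expr_sum; apply: eq_bigr => i _.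
  by rewrite unfold_in; case: ifP.
rewrite (eq_bigr _ (fun i _ => sum_anticomm1 (f i))) (bigID (fun i => f i != PauliI)) /=.
congr (_ * _).
  rewrite (eq_bigr (fun=> 1 + (-1) *: 'X)) => [|i /negPf -> //].
  by rewrite prodr_const /pauli_wt cardsE.
rewrite (eq_bigr (fun=> 1 + 3 *: 'X)) => [|i]; last by rewrite negbK => ->.
rewrite prodr_const; congr (_ ^+ _).
have := cardC [set i | f i != PauliI]; rewrite card_ord -/(pauli_wt f) => wtC.
rewrite -[LHS](addKn (pauli_wt f)); congr (_ - _)%N; rewrite -[RHS]wtC; congr (_ + _)%N.
by apply: eq_card => i; rewrite !inE.
Qed.

(* A list fold, because the locked [\sum] does not compute. *)
Definition krawtchouk_int (n j r : nat) : int :=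
  foldr +%R 0 [seq (-1) ^+ s * 3 ^+ (j - s)%N * ('C(r, s))%:Z * ('C(n - r, j - s))%:Z
              | s <- iota 0 j.+1].

Lemma krawtchouk_intE (n j r : nat) :
  krawtchouk_int n j r = \sum_(s < j.+1)
    (-1) ^+ s * 3 ^+ (j - s)%N * ('C(r, s))%:Z * ('C(n - r, j - s))%:Z.
Proof.
by rewrite /krawtchouk_int foldrE big_map -/(index_iota 0 j.+1) big_mkord.
Qed.

Lemma sum_sign_weight n (f : {ffun 'I_n -> pauli1}) j :
  \sum_(e : {ffun 'I_n -> pauli1} | pauli_wt e == j) (-1) ^+ anticomm e f =
  krawtchouk_int n j (pauli_wt f).
Proof.
have /(congr1 (fun p : {poly int} => p`_j)) := pauli_enumerator f.
rewrite coefM coef_sum => H; rewrite krawtchouk_intE big_mkcond /=.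
transitivity (\sum_e ((-1) ^+ anticomm e f *: 'X^(pauli_wt e) : {poly int})`_j).
  apply: eq_bigr => e _; rewrite coefZ coefXn [j == _]eq_sym.
  by case: eqP; rewrite ?mulr1 ?mulr0.
rewrite H; apply: eq_bigr => s _.
by rewrite !coef_expr1DZX !pmulrn; ring.
Qed.

(** * Nonexistence at the level of labels *)

Lemma no_additive_code_7_4_3 (G : {set {ffun 'I_7 -> pauli1}}) :
  additive_set G -> isotropic G -> #|G| = 32%N ->
  (forall e, (pauli_wt e < 3)%N -> e \in annihilator G -> e \in G) -> False.
Proof.
move=> Gadd Giso G32 dist.
pose K := krawtchouk_int 7.
have GA e : e \in G -> e \in annihilator G.
  by move=> eG; rewrite inE; apply/forall_inP => f; apply: Giso.
(* MacWilliams identity: exchanging the sums counts 32 times the labels of weight [j] in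
   [annihilator G], and for [j < 3] these are exactly those in [G]. *)
have dual j : (j < 3)%N ->
    \sum_(f in G) (K j (pauli_wt f) - 32 * (pauli_wt f == j)%:R) = 0.
  move=> j3; rewrite sumrB; apply/eqP; rewrite subr_eq0 -mulr_sumr; apply/eqP.
  under eq_bigr do rewrite /K -sum_sign_weight.
  rewrite exchange_big /=; under eq_bigr do rewrite sum_character // G32.
  rewrite -mulr_sumr; congr (_ * _).
  rewrite big_mkcond [RHS]big_mkcond; apply: eq_bigr => e _ /=.
  have [ej|_] := eqVneq (pauli_wt e) j; last by case: ifP.
  case: (boolP (e \in annihilator G)) => [/(dist _)|eA]; first by rewrite ej => ->.
  by case: ifP => // /GA; rewrite (negPf eA).
(* For each fixed [e], parity times the character of [e] is again a character of [G], so its sum is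
   0 or 32. *)
have shadow j : 0 <= \sum_(f in G) (-1) ^+ odd (pauli_wt f) * K j (pauli_wt f).
  under eq_bigr do rewrite /K -sum_sign_weight mulr_sumr.
  rewrite exchange_big sumr_ge0 // => e _.
  under eq_bigr do rewrite -signr_addb.
  rewrite sum_sign_additive //; first by case: ifP.
  move=> f g fG gG /=; rewrite odd_wtD (negPf (Giso _ _ fG gG)) addbF anticommDr.
  by rewrite -!addbA; congr (_ (+) _); rewrite addbCA.
(* The multipliers form a Farkas certificate for the infeasible linear program. *)
pose term w : int :=
  - 5 * (K 0%N w - 32 * (w == 0%N)%:R) - 2 * (K 1%N w - 32 * (w == 1%N)%:R)
  - (K 2%N w - 32 * (w == 2%N)%:R)
  + 2 * ((-1) ^+ odd w * K 0%N w) + 2 * ((-1) ^+ odd w * K 1%N w).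
have term_le0 w : (w < 8)%N -> term w <= 0.
  by do 8 (case: w => [|w] //).
have wt8 (e : {ffun 'I_7 -> pauli1}) : (pauli_wt e < 8)%N.
  by apply: leq_ltn_trans (max_card _) _; rewrite card_ord.
have : 0 <= \sum_(f in G) term (pauli_wt f).
  rewrite !big_split /= !sumrN -!mulr_sumr !dual // !mulr0 !subr0 add0r.
  by rewrite addr_ge0 // mulr_ge0.
(* The zero label contributes [term 0 = -32] and every other label at most 0, so the sum is
   negative. *)
rewrite (bigD1 (0 : {ffun 'I_7 -> pauli1})) /=; last by case: Gadd.
rewrite wt0; apply/negP; rewrite -ltNge.
apply: (@le_lt_trans _ _ (term 0%N + 0)) => //.
by rewrite lerD2l sumr_le0 // => f _; exact: term_le0.
Qed.

(** [offdiag] and [diag] are the Knill-Laflamme conditions on labels: no error of low weight carries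
    one word state to another, and one that stabilizes the state has the same sign on all words. *)
Lemma no_cws_labels_7_3_3 (L : {set {ffun 'I_7 -> pauli1}})
    (a : 'I_3 -> {ffun 'I_7 -> pauli1}) :
  additive_set L -> isotropic L -> (2 ^ 7 <= #|L|)%N ->
  (forall e i j, (pauli_wt e < 3)%N -> i != j -> e + (a i + a j) \notin L) ->
  (forall e i j, (pauli_wt e < 3)%N -> e \in L -> anticomm e (a i) = anticomm e (a j)) ->
  False.
Proof.
move=> Ladd Liso Lge offdiag diag; have [LK L128] := self_dual Ladd Liso Lge.
pose i0 : 'I_3 := ord0; pose i1 : 'I_3 := lift ord0 ord0; pose i2 : 'I_3 := ord_max.
pose u := a i0 + a i1; pose v := a i0 + a i2.
(* The third nonzero element of the group generated by [u] and [v] is again a difference of two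
   words, so [offdiag] excludes all three nontrivial cosets of [L]. *)
have uvE : u + v = a i1 + a i2 by rewrite /u /v addrACA label_addrr add0r.
pose G := [set f in L | ~~ anticomm u f && ~~ anticomm v f].
have [L0 LD] := Ladd.
have Gadd : additive_set G.
  split; first by rewrite inE L0 ![anticomm _ 0]anticommC !anticomm0l.
  move=> f g; rewrite !inE => /and3P[fL uf vf] /and3P[gL ug vg].
  by rewrite LD // !anticommDr !(negPf uf) !(negPf vf) !(negPf ug) !(negPf vg).
have Giso : isotropic G.
  by move=> f g; rewrite !inE => /andP[fL _] /andP[gL _]; exact: Liso.
have memL e : (pauli_wt e < 3)%N ->
    4 * \sum_(f in G) (-1) ^+ anticomm e f = 128 * (e \in L)%:R :> int.
  move=> e3; rewrite sum_character_kernel // L128 -addrA uvE.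
  rewrite (negPf (offdiag e i0 i1 e3 _)) // (negPf (offdiag e i0 i2 e3 _)) //.
  by rewrite (negPf (offdiag e i1 i2 e3 _)) // !addn0.
(* At [e = 0] the character sum is the order of [G], so [4 * #|G| = 128]. *)
have G32 : #|G| = 32%N.
  have := memL 0; rewrite wt0 L0 sum_character // => /(_ isT).
  rewrite (_ : 0 \in annihilator G); first by lia.
  by rewrite inE; apply/forall_inP => f _; rewrite anticomm0l.
apply: (no_additive_code_7_4_3 Gadd Giso G32) => e e3 eG.
have eL : e \in L.
  have := memL e e3; rewrite sum_character // eG G32.
  by case: (e \in L).
rewrite inE eL /u /v ![anticomm _ e]anticommC !anticommDr.
by rewrite (diag e i0 i1 e3 eL) (diag e i2 i1 e3 eL) addbb.
Qed.

(** * From labels to Pauli matrices *)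

Section PauliOperators.

Variable C : numClosedFieldType.

Definition pauli1_phase (p q : pauli1) : C :=
  match p, q with
  | PauliX, PauliY | PauliY, PauliZ | PauliZ, PauliX => 'i
  | PauliY, PauliX | PauliZ, PauliY | PauliX, PauliZ => - 'i
  | _, _ => 1
  end.

Lemma mulCii : 'i * 'i = -1 :> C. Proof. by rewrite -expr2 sqrCi. Qed.

Lemma pauli1_mxM p q :
  pauli1_mx C p *m pauli1_mx C q = pauli1_phase p q *: pauli1_mx C (p + q).
Proof.
have i2 := mulCii.
case: p; case: q; rewrite /= ?mul1mx ?mulmx1 ?scale1r //;
  apply/matrixP => a b; rewrite !mxE !big_ord_recl big_ord0 !mxE;
  case: a => [[|[|a]] //= ha]; case: b => [[|[|b]] //= hb];
  by rewrite /= ?mulr0 ?mul0r ?addr0 ?add0r ?(mulrN, mulNr, opprK)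
     ?mulr1 ?mul1r ?oppr0 ?i2 ?opprK.
Qed.

Lemma pauli1_phaseC p q :
  pauli1_phase p q = (-1) ^+ anticomm1 p q * pauli1_phase q p.
Proof. by case: p; case: q; rewrite /= ?expr1 ?expr0 ?mul1r ?mulN1r ?opprK. Qed.

Lemma pauli1_phase_neq0 p q : pauli1_phase p q != 0.
Proof. by case: p; case: q; rewrite /= ?oppr_eq0 ?neq0Ci ?oner_neq0. Qed.

Lemma pauli1_mx_herm p : (pauli1_mx C p)^t* = pauli1_mx C p.
Proof.
apply/matrixP => a b; rewrite !mxE.
case: p => /=; rewrite !mxE; case: a => [[|[|a]] //= ha]; case: b => [[|[|b]] //= hb];
 by rewrite /= ?rmorphN /= ?conjCi ?rmorph1 ?rmorph0 ?opprK.
Qed.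

Variable n : nat.
Implicit Types (e f g u v : {ffun 'I_n -> pauli1}).
Local Notation P := (@pauli_tensor C n).

Definition pauli_phase e f : C := \prod_i pauli1_phase (e i) (f i).

(** The mixed-product rule for Kronecker products: a product over sites of one-site sums expands
    into a sum over intermediate bit strings, which [qbits] enumerates. *)
Lemma pauli_tensorM e f : P e *m P f = pauli_phase e f *: P (e + f).
Proof.
apply/matrixP => a b; rewrite !mxE /pauli_phase -big_split /=.
rewrite (eq_bigr (fun i =>
    \sum_k pauli1_mx C (e i) (qbits a i) k * pauli1_mx C (f i) k (qbits b i))).
  rewrite bigA_distr_bigA /= (reindex (@qbits n)) /=; last first.
    by exists enum_rank => x _; [exact: enum_valK|exact: enum_rankK].
  by apply: eq_bigr => c _; rewrite !mxE -big_split.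
move=> i _; rewrite ffunE.
by have /matrixP/(_ (qbits a i) (qbits b i)) := pauli1_mxM (e i) (f i); rewrite !mxE.
Qed.

Lemma pauli_phase_neq0 e f : pauli_phase e f != 0.
Proof. by apply/prodf_neq0 => i _; exact: pauli1_phase_neq0. Qed.

Lemma pauli_phaseC e f : pauli_phase e f = (-1) ^+ anticomm e f * pauli_phase f e.
Proof.
rewrite /anticomm (big_morph (fun b : bool => (-1) ^+ b : C) (@signr_addb _)
            (erefl : _ false = 1)).
by rewrite -big_split; apply: eq_bigr => i _; exact: pauli1_phaseC.
Qed.

Lemma pauli_tensorC e f : P e *m P f = (-1) ^+ anticomm e f *: (P f *m P e).
Proof. by rewrite !pauli_tensorM pauli_phaseC scalerA addrC. Qed.

Lemma pauli_tensor0 : P 0 = 1%:M.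
Proof.
apply/matrixP => a b; rewrite !mxE; have [<-|ab] := eqVneq a b.
  by rewrite big1 // => i _; rewrite ffunE /= mxE eqxx.
have /existsP [i abi] : [exists i, qbits a i != qbits b i].
  apply: contraR ab; rewrite negb_exists => /forallP H.
  by apply/eqP/enum_val_inj/ffunP => i; apply/eqP; rewrite -[_ == _]negbK.
by rewrite (bigD1 i) //= ffunE /= mxE (negPf abi) mul0r.
Qed.

Lemma pauli_tensor_sqr e : P e *m P e = 1%:M.
Proof.
rewrite pauli_tensorM label_addrr pauli_tensor0 /pauli_phase big1 ?scale1r // => i _.
by case: (e i).
Qed.

Lemma pauli_tensor_herm e : (P e)^t* = P e.
Proof.
apply/matrixP => a b; rewrite !mxE rmorph_prod; apply: eq_bigr => i _.
by have /matrixP/(_ (qbits a i) (qbits b i)) := pauli1_mx_herm (e i); rewrite !mxE.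
Qed.

End PauliOperators.

(** * Inner products and stabilizer states *)

Section Braket.
Variables (C : numClosedFieldType) (m : nat).
Implicit Types (x y : 'cV[C]_m) (A : 'M[C]_m) (k : C).

Lemma braketZr k x y : braket x (k *: y) = k * braket x y.
Proof. by rewrite /braket -scalemxAr mxE. Qed.

Lemma braketZl k x y : braket (k *: x) y = k^* * braket x y.
Proof. by rewrite /braket linearZ /= map_mxZ -scalemxAl mxE. Qed.

Lemma braket_adjoint A x y : braket (A *m x) y = braket x (A^t* *m y).
Proof. by rewrite /braket trmx_mul map_mxM mulmxA. Qed.

End Braket.

Section StabilizerState.

Variables (C : numClosedFieldType) (n : nat) (psi : 'cV[C]_(qdim n)).
Hypothesis psi1 : braket psi psi = 1.
Notation P := (@pauli_tensor C n).

(** Since [P e] squares to the identity, its eigenvalues are signs; these are therefore all the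
    labels that have [psi] as an eigenvector. *)
Definition stabilizer_labels : {set {ffun 'I_n -> pauli1}} :=
  [set e | (P e *m psi == psi) || (P e *m psi == - psi)].

Lemma scale_state_inj : injective (fun c => c *: psi).
Proof.
by move=> c d /(congr1 (braket psi)); rewrite !braketZr psi1 !mulr1.
Qed.

Lemma eigen_stabilizer_label e c : P e *m psi = c *: psi -> e \in stabilizer_labels.
Proof.
move=> eP; rewrite inE eP.
have /eqP : c ^+ 2 = 1.
  apply: scale_state_inj; rewrite scale1r expr2 -scalerA -eP scalemxAr -eP.
  by rewrite mulmxA pauli_tensor_sqr mul1mx.
by rewrite sqrf_eq1 => /orP[] /eqP ->; rewrite ?scale1r ?scaleN1r eqxx ?orbT.
Qed.

Lemma stabilizer_labelP e : e \in stabilizer_labels ->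
  exists2 c, c != 0 & P e *m psi = c *: psi.
Proof.
rewrite inE => /orP[] /eqP ->; [exists 1|exists (-1)];
  by rewrite ?scale1r ?scaleN1r ?oppr_eq0 ?oner_neq0.
Qed.

Lemma stabilizer_labels_additive : additive_set stabilizer_labels.
Proof.
split=> [|f g /stabilizer_labelP[c _ fc] /stabilizer_labelP[d _ gd]].
  by apply: (eigen_stabilizer_label (c := 1)); rewrite pauli_tensor0 mul1mx scale1r.
apply: (eigen_stabilizer_label (c := (pauli_phase C f g)^-1 * (d * c))).
rewrite -!scalerA -fc scalemxAr -gd mulmxA pauli_tensorM -scalemxAl scalerA.
by rewrite mulVf ?scale1r // pauli_phase_neq0.
Qed.

(** Anticommuting operators with common eigenvector [psi] would have eigenvalues with
    [c * d = - (c * d)], although both are nonzero. *)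
Lemma stabilizer_labels_isotropic : isotropic stabilizer_labels.
Proof.
move=> f g /stabilizer_labelP[c c0 fc] /stabilizer_labelP[d d0 gd].
have := congr1 (mulmxr psi) (pauli_tensorC C f g).
rewrite /= -scalemxAl -!mulmxA fc gd -!scalemxAr fc gd !scalerA => /scale_state_inj.
case: (anticomm f g) => //=; rewrite expr1 mulN1r mulNr [c * d]mulrC => /eqP.
by rewrite -subr_eq0 opprK -mulr2n mulrn_eq0 mulf_eq0 (negPf c0) (negPf d0).
Qed.

(** Fixing [psi] determines the phase of an element of [S] from its label, so [S] lies in the image
    of the labels under [lift], which picks the sign that fixes [psi]. *)
Lemma card_stabilizer_labels (S : {fset 'M[C]_(qdim n)}) :
  (forall s, s \in S -> is_pauli s) -> (forall s, s \in S -> s *m psi = psi) ->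
  (#|` S| <= #|stabilizer_labels|)%N.
Proof.
move=> Spauli Spsi.
pose lift e := if P e *m psi == psi then P e else - P e.
rewrite cardE -(size_map lift); apply: uniq_leq_size; first exact: fset_uniq.
move=> s sS; have [k [e sE]] := Spauli _ sS; have := Spsi _ sS.
rewrite sE; set c := 'i ^+ k; rewrite -scalemxAl => cP.
have c0 : c != 0 by rewrite expf_neq0 // neq0Ci.
have eP : P e *m psi = c^-1 *: psi by rewrite -[in RHS]cP scalerA mulVf // scale1r.
have eL := eigen_stabilizer_label eP.
apply/mapP; exists e; first by rewrite mem_enum.
rewrite /lift; case: eqP => [E|nE].
  by move: cP; rewrite E -[in RHS](scale1r psi) => /scale_state_inj ->; rewrite scale1r.
move: eL; rewrite inE => /orP[/eqP //|/eqP E]; move: cP.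
rewrite E scalerN -scaleNr -[in RHS](scale1r psi) => /scale_state_inj /eqP.
by rewrite eqr_oppLR => /eqP ->; rewrite scaleN1r.
Qed.

End StabilizerState.

(** * From a CWS code to its labels *)

Lemma projector_detection (C : numClosedFieldType) (m : nat) (U : {vspace 'cV[C]_m})
    (Q E : 'M[C]_m) (c : C) :
  is_orth_projector U Q -> Q *m E *m Q = c *: Q ->
  forall x y, x \in U -> y \in U -> braket x (E *m y) = c * braket x y.
Proof.
move=> [_ Qh QU] QEQ x y /QU Qx /QU Qy.
by rewrite -{1}Qx braket_adjoint Qh -{1}Qy !mulmxA QEQ -scalemxAl Qy braketZr.
Qed.

Lemma no_cws_code_7_3_3 (C : numClosedFieldType) (U : {vspace 'cV[C]_(qdim 7)}) :
  is_cws_code 3 U -> is_quantum_code 3 3 U -> False.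
Proof.
move=> [S [psi [w [[[Spauli _ _ _] _ Scard _] [psi1 Spsi] wpauli worth UE]]]].
move=> [_ [Q Qproj Qdet]].
have /fin_all_exists[a /fin_all_exists[c cw]] : forall i, exists e,
    exists c : C, c != 0 /\ w i = c *: pauli_tensor C e.
  move=> i; have [k [e ->]] := wpauli i; exists e, ('i ^+ k).
  by rewrite expf_neq0 // neq0Ci.
have wU i : w i *m psi \in U.
  by rewrite UE; apply/memv_span/mapP; exists i; rewrite ?mem_enum.
pose L := stabilizer_labels psi.
have brE e i j : braket (w i *m psi) (pauli_tensor C e *m (w j *m psi)) =
    (c i)^* * c j * braket psi (pauli_tensor C (a i) *m pauli_tensor C e *m
      pauli_tensor C (a j) *m psi).
  have [_ ->] := cw i; have [_ ->] := cw j.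
  rewrite -!scalemxAl -scalemxAr braketZl braketZr braket_adjoint pauli_tensor_herm.
  by rewrite !mulmxA mulrA.
have det e : (pauli_wt e < 3)%N -> exists l, forall i j,
      braket (w i *m psi) (pauli_tensor C e *m (w j *m psi)) =
    l * braket (w i *m psi) (w j *m psi).
  move=> e3; have [l] := Qdet ord0 e e3; rewrite expr0 scale1r => QEQ.
  by exists l => i' j'; apply: (projector_detection Qproj QEQ).
have cc0 i j : (c i)^* * c j != 0.
  by rewrite mulf_neq0 ?conjC_eq0; have [] := cw i; have [] := cw j.
apply: (@no_cws_labels_7_3_3 L a).
- exact: stabilizer_labels_additive.
- exact: stabilizer_labels_isotropic.
- by rewrite -Scard card_stabilizer_labels.
(* Were the label in [L], the matrix element of [e] between words [i] and [j] would be a nonzero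
   multiple of [braket psi psi], while detection and orthogonality make it 0. *)
- move=> e i j e3 ij; apply/negP => /stabilizer_labelP [d d0 dP].
  have [l lP] := det e e3; have := lP i j.
  rewrite brE worth // mulr0 => /eqP; rewrite mulf_eq0 (negPf (cc0 i j)) /=.
  rewrite !pauli_tensorM -scalemxAl pauli_tensorM -!scalemxAl.
  rewrite [a i + e]addrC -addrA dP !braketZr psi1 mulr1.
  by rewrite !mulf_eq0 !(negPf (pauli_phase_neq0 _ _ _)) (negPf d0).
(* On word [k] the operator of [e] has eigenvalue [d] up to the commutation sign with [a k];
   detection makes this value the same [l] for every [k]. *)
- move=> e i j e3 /stabilizer_labelP [d d0 dP].
  have [l lP] := det e e3.
  have lE k : (-1) ^+ anticomm e (a k) * d = l.
    apply: (mulfI (cc0 k k)); have := lP k k.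
    (* Inserting the identity as [pauli_tensor C 0] lets [brE] expand the squared norm too, so that
       the same phase factor cancels on both sides. *)
    have {4}-> : w k *m psi = pauli_tensor C 0 *m (w k *m psi).
      by rewrite pauli_tensor0 mul1mx.
    rewrite !brE pauli_tensorC pauli_tensor0 mulmx1 pauli_tensor_sqr mul1mx psi1 mulr1.
    rewrite -!scalemxAl -[_ *m pauli_tensor C (a k)]mulmxA pauli_tensor_sqr mulmx1 dP.
    by rewrite !braketZr psi1 mulr1 anticommC => ->; rewrite mulrC.
  by have := lE i; rewrite -(lE j) => /(mulIf d0) /signr_inj.
Qed.

(** * Feasibility of the linear program *)

Lemma krawtchoukE (R : realType) (n j r : nat) :
  krawtchouk R n j r = (krawtchouk_int n j r)%:~R.
Proof.
rewrite /krawtchouk krawtchouk_intE rmorph_sum; apply: eq_bigr => s _.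
by rewrite !rmorphM !rmorphXn /= rmorphN1 !pmulrn.
Qed.

(** Row [j], column [r]. Literal entries turn the constraints into closed numerical statements for
    [lra]. *)
Definition krawtchouk7 : seq (seq int) :=
  [:: [:: 1; 1; 1; 1; 1; 1; 1; 1];
      [:: 21; 17; 13; 9; 5; 1; -3; -7];
      [:: 189; 117; 61; 21; -3; -11; -3; 21];
      [:: 945; 405; 105; -19; -31; 5; 25; -35];
      [:: 2835; 675; -45; -93; 19; 35; -45; 35];
      [:: 5103; 243; -297; 27; 63; -61; 39; -21];
      [:: 5103; -729; -81; 135; -81; 39; -17; 7];
      [:: 2187; -729; 243; -81; 27; -9; 3; -1]].

Lemma krawtchouk7E (R : realType) (j r : nat) : (j < 8)%N -> (r < 8)%N ->
  krawtchouk R 7 j r = (nth 0 (nth [::] krawtchouk7 j) r)%:~R.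
Proof.
move=> j8 r8; rewrite krawtchoukE; congr _%:~R.
have -> : krawtchouk7 = mkseq (fun j => mkseq (krawtchouk_int 7 j) 8) 8.
  by vm_compute.
by rewrite !nth_mkseq.
Qed.

Lemma lp_solution_7_3_3 (R : realType) : exists A : 'I_8 -> R, lp_solution 3 3 A.
Proof.
(* This point is determined by [A_0 = 1], [A_2 = A_3 = 0], the equalities [B_j = A_j] for [j < 3],
   and vanishing shadow entries at [j = 0] and [j = 1]. *)
pose a : seq R := [:: 1; 1/5; 0; 0; 83/15; 93/5; 74/5; 38/15].
pose A := fun i : 'I_8 => a`_i.
have dualE (j : 'I_8) : lp_dual 3 A j =
   3 / 2 ^+ 7 * \sum_(r < 8) (nth 0 (nth [::] krawtchouk7 j) r)%:~R * a`_r.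
  by rewrite /lp_dual; congr (_ * _); apply: eq_bigr => r _; rewrite krawtchouk7E.
have shadowE (j : 'I_8) : lp_shadow 3 A j =
   3 / 2 ^+ 7 * \sum_(r < 8) (-1) ^+ r * (nth 0 (nth [::] krawtchouk7 j) r)%:~R * a`_r.
  by rewrite /lp_shadow; congr (_ * _); apply: eq_bigr => r _; rewrite krawtchouk7E.
exists A; split=> //.
- move=> [k h]; rewrite dualE !big_ord_recl big_ord0 /A /=.
  by move: h; do 8 (case: k => [_|k] /=; first lra).
- move=> [k h] /= k3; rewrite dualE !big_ord_recl big_ord0 /A /=.
  by move: h k3; do 3 (case: k => [_ _|k] /=; first lra).
- move=> [k h]; rewrite shadowE !big_ord_recl big_ord0 /bump /=.
  by move: h; do 8 (case: k => [_|k] /=; first lra).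
Qed.

Theorem corollary3 (R : realType) :
  (~ exists U : {vspace 'cV[R[i]]_(qdim 7)},
       is_cws_code 3 U /\ is_quantum_code 3 3 U) /\
  ~ lp_rules_out R 7 3 3.
Proof.
split=> [[U [cwsU codeU]]|]; first exact: no_cws_code_7_3_3 cwsU codeU.
by apply; exact: lp_solution_7_3_3.
Qed.
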